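(* Let $n\ge 1$ and let $X_1,\dots,X_n$ be operators in a complex Hilbert space $\mathcal{H}$, each of which is Hermitian or skew-Hermitian, all defined on a common invariant domain $D$ (i.e. $D\subset \mathrm{Dom}(X_j)$ and $X_jD\subset D$ for all $j$), and suppose that $[X_i,X_j]=c_{ij}I$ on $D$ for some constants $c_{ij}\in\mathbb{C}$, $i,j\in\{1,\dots,n\}$. Let $m^{(1)},\dots,m^{(n)}$ be sequences of positive numbers satisfying (A0), (A1), (A2), and such that the pair $(m^{(i)},m^{(j)})$ satisfies (A3) for every pair $(i,j)$ with $c_{ij}\neq 0$. Put $\mathbf{m}=(m^{(1)},\dots,m^{(n)})$, $\mathbf{X}=(X_1,\dots,X_n)$. Then a vector $u\in D$ belongs to $\mathcal{S}_{\mathbf{m}}(\mathbf{X})$ if and only if $u\in \mathcal{S}_{m^{(1)}}(X_1)\cap\dots\cap\mathcal{S}_{m^{(n)}}(X_n)$.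
   Context: Notation: $M(n)=\bigcup_{k\ge1}\{1,\dots,n\}^k$ is the set of multiindices; for $\alpha=(i_1,\dots,i_k)\in M(n)$, $|\alpha|=k$ and $|\alpha|_j=\mathrm{card}\{l: i_l=j\}$. For operators $\mathbf{X}=(X_1,\dots,X_n)$ in $\mathcal{H}$, $\mathbf{X}_\alpha=X_{i_1}\cdots X_{i_k}$ and $C^\infty(\mathbf{X})=\{u\in\mathcal{H}: u\in \mathrm{Dom}(\mathbf{X}_\alpha)\ \forall \alpha\in M(n)\}$. For sequences $m^{(j)}=(m^{(j)}_p)_{p\in\mathbb{N}}$ of positive reals and $\mathbf{m}=(m^{(1)},\dots,m^{(n)})$, set $\mathbf{m}_\alpha=m^{(1)}_{|\alpha|_1}\cdots m^{(n)}_{|\alpha|_n}$. The space of $\mathbf{m}$-Gelfand–Shilov–Roumieu vectors is $\mathcal{S}_{\mathbf{m}}(\mathbf{X})=\{u\in C^\infty(\mathbf{X}): \exists A,C>0,\ \|\mathbf{X}_\alpha u\|\le CA^{|\alpha|}\mathbf{m}_\alpha\ \forall\alpha\in M(n)\}$; in particular for a single operator $Y$ and a single sequence $m$, $\mathcal{S}_m(Y)=\{u\in C^\infty(Y):\exists A,C>0,\ \|Y^ku\|\le CA^km_k\ \forall k\ge1\}$. Conditions: (A0) $m^{(j)}_0=m^{(j)}_1=1$ for all $j$; (A1) $(m^{(j)}_p)^2\le m^{(j)}_{p-1}m^{(j)}_{p+1}$ for all $j$ and $p\ge1$; (A2) there is $H>0$ with $m^{(j)}_{p+q}\le H^{p+q}m^{(j)}_pm^{(j)}_q$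 for all $j$ and $p,q\in\mathbb{N}$. A pair of sequences $(m^{(j)},m^{(k)})$ satisfies (A3) if there is $L\ge1$ with $p\,m^{(j)}_{p-1}m^{(k)}_{p-1}\le L\,m^{(j)}_pm^{(k)}_p$ for all $p\ge1$. $[Y,Z]=YZ-ZY$. *)

(* Defs.v *)
(* complex Hilbert space over R[i], R : realType. *)
From HB Require Import structures.
From mathcomp Require Import all_boot all_order all_algebra.
From mathcomp Require Import reals complex.
Set Implicit Arguments. Unset Strict Implicit. Unset Printing Implicit Defensive.
Import Order.TTheory GRing.Theory Num.Theory.
Local Open Scope ring_scope.
Local Open Scope complex_scope.

Section Hilbert.
Variables (R : realType) (H : lmodType R[i]) (ip : H -> H -> R[i]).

(* norm induced by the inner product *)
Definition hnorm (u : H) : R := Num.sqrt (complex.Re (ip u u)).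

(* inner product: linear in the first slot, hermitian symmetric, positive definite;
   plus completeness w.r.t. the induced norm *)
Definition is_hilbert : Prop :=
  [/\ (forall (a : R[i]) (u v w : H), ip (a *: u + v) w = a * ip u w + ip v w),
      (forall u v : H, ip u v = (ip v u)^*),
      (forall u : H, 0 <= ip u u),
      (forall u : H, ip u u = 0 -> u = 0) &
      (forall s : nat -> H,
         (forall e : R, 0 < e -> exists N, forall p q, (N <= p)%N -> (N <= q)%N ->
             hnorm (s p - s q) < e) ->
         exists l : H, forall e : R, 0 < e -> exists N, forall p, (N <= p)%N ->
             hnorm (s p - l) < e)].

(* an operator is given by a domain predicate and an action on it *)
Definition herm_op (dom : H -> Prop) (X : H -> H) : Prop :=
  forall u v, dom u -> dom v -> ip (X u) v = ip u (X v).
Definition skew_herm_op (dom : H -> Prop) (X : H -> H) : Prop :=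
  forall u v, dom u -> dom v -> ip (X u) v = - ip u (X v).

Variable n : nat.
Variables (dom : 'I_n -> H -> Prop) (X : 'I_n -> H -> H).

(* X_alpha = X_{i1} ... X_{ik} for alpha = [:: i1; ...; ik] *)
Fixpoint apply_word (a : seq 'I_n) (u : H) : H :=
  if a is i :: s then X i (apply_word s u) else u.
Fixpoint in_dom_word (a : seq 'I_n) (u : H) : Prop :=
  if a is i :: s then in_dom_word s u /\ dom i (apply_word s u) else True.

Definition Cinf (u : H) : Prop := forall a : seq 'I_n, (0 < size a)%N -> in_dom_word a u.

(* m_alpha = prod_j m^(j)_{|alpha|_j} *)
Definition m_word (m : 'I_n -> nat -> R) (a : seq 'I_n) : R :=
  \prod_(j < n) m j (count_mem j a).

(* S_m(X) *)
Definition GSR (m : 'I_n -> nat -> R) (u : H) : Prop :=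
  Cinf u /\ exists A C : R, 0 < A /\ 0 < C /\
    forall a : seq 'I_n, (0 < size a)%N ->
      hnorm (apply_word a u) <= C * A ^+ size a * m_word m a.
End Hilbert.

Section Single.
Variables (R : realType) (H : lmodType R[i]) (ip : H -> H -> R[i]).
Variables (domY : H -> Prop) (Y : H -> H).

Fixpoint in_dom_pow (k : nat) (u : H) : Prop :=
  if k is k'.+1 then in_dom_pow k' u /\ domY (iter k' Y u) else True.

(* S_m(Y) for a single operator and a single sequence *)
Definition GSR1 (m : nat -> R) (u : H) : Prop :=
  (forall k, in_dom_pow k u) /\ exists A C : R, 0 < A /\ 0 < C /\
    forall k : nat, (1 <= k)%N -> hnorm ip (iter k Y u) <= C * A ^+ k * m k.
End Single.

(* conditions on the weight sequences *)
Section Seqs.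
Variable R : realType.
Definition condA0 n (m : 'I_n -> nat -> R) := forall j, m j 0%N = 1 /\ m j 1%N = 1.
Definition condA1 n (m : 'I_n -> nat -> R) :=
  forall j p, (1 <= p)%N -> m j p ^+ 2 <= m j p.-1 * m j p.+1.
Definition condA2 n (m : 'I_n -> nat -> R) :=
  exists Hc : R, 0 < Hc /\ forall j p q, m j (p + q)%N <= Hc ^+ (p + q) * m j p * m j q.
Definition condA3 (mj mk : nat -> R) :=
  exists L : R, 1 <= L /\ forall p, (1 <= p)%N -> p%:R * mj p.-1 * mk p.-1 <= L * mj p * mk p.
End Seqs.

(* Main.v *)
(* Since the operators are symmetric up to sign, ||X_a u||^2 = |<X_w u, u>| with
   w = rev a ++ a, so it suffices to bound |<X_w u, u>| by C B^|w| m_w; (A2) then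
   splits m_w into m_a^2.  Letters are admitted one at a time.  To admit the
   letter j, every X_j in w is moved to the left end and then to the right
   factor of the inner product, which yields terms c <X_b u, X_j^p u> controlled
   by Cauchy-Schwarz, the bound on words without j, and the bound on the powers
   of X_j.  A commutation cancels a pair (i, j) and creates combinatorial factors
   which, up to exponentials, amount to k! for k cancelled pairs; by (A3),
   k! <= L^k m^(i)_k m^(j)_k, and log-convexity (A1) reabsorbs these weights
   through m_p m_q <= m_(p+q). *)
Require Import Defs.
From HB Require Import structures.
From mathcomp Require Import all_boot all_order all_algebra.
From mathcomp Require Import reals complex.
From mathcomp Require Import zify ring lra.
Import Order.TTheory GRing.Theory Num.Theory.
Local Open Scope ring_scope.
Local Notation cmod := Normc.normc.

(** * Weight sequences and falling factorials *)

(** Log-convexity makes the ratios [m p.+1 / m p] nondecreasing; the inequality is this monotonicity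
    with denominators cleared. *)
Lemma log_convex_ratio_le (R : realType) (m : nat -> R) :
  (forall p, 0 < m p) ->
  (forall p, (1 <= p)%N -> m p ^+ 2 <= m p.-1 * m p.+1) ->
  forall p q, m p.+1 * m (p + q)%N <= m p * m (p + q).+1.
Proof.
move=> mpos mconv p; elim=> [|q IH]; first by rewrite addn0 mulrC.
rewrite addnS; set s := (p + q)%N in IH *.
rewrite -(ler_pM2l (mpos s)).
apply: (@le_trans _ _ (m p * m s.+1 ^+ 2)).
  by rewrite expr2 !mulrA ler_pM2r // mulrC.
by rewrite [m s * _]mulrCA ler_pM2l // mconv.
Qed.

(** Since [m 0 = 1], the index [p] can be transferred to [q] one unit at a time, each transfer being
    an instance of the ratio inequality. *)
Lemma log_convex_superM (R : realType) (m : nat -> R) :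
  (forall p, 0 < m p) -> m 0%N = 1 ->
  (forall p, (1 <= p)%N -> m p ^+ 2 <= m p.-1 * m p.+1) ->
  forall p q, m p * m q <= m (p + q)%N.
Proof.
move=> mpos m0 mconv; elim=> [|p IH] q; first by rewrite m0 mul1r.
rewrite -(ler_pM2l (mpos p)) addSn.
apply: le_trans (log_convex_ratio_le _ _ mpos mconv p q).
by rewrite mulrCA ler_pM2l.
Qed.

Lemma log_convex_prod_superM (R : realType) (m : nat -> R) (I : finType)
    (k : I -> nat) :
  (forall p, 0 < m p) -> m 0%N = 1 ->
  (forall p, (1 <= p)%N -> m p ^+ 2 <= m p.-1 * m p.+1) ->
  forall p, m p * \prod_i m (k i) <= m (p + \sum_i k i)%N.
Proof.
move=> mpos m0 mconv p; apply: le_trans (log_convex_superM _ _ mpos m0 mconv _ _).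
rewrite ler_pM2l //; elim/big_rec2: _ => [|i s t _ IH]; first by rewrite m0.
apply: le_trans (log_convex_superM _ _ mpos m0 mconv _ _).
by rewrite ler_pM2l.
Qed.

(** Iterating (A3) from [k] down to 0 produces the factors of the factorial; the product starts at
    [m_0 = 1]. *)
Lemma fact_le_weights (R : realType) (mj mk : nat -> R) (L : R) : 0 <= L ->
  mj 0%N = 1 -> mk 0%N = 1 ->
  (forall p, (1 <= p)%N -> p%:R * mj p.-1 * mk p.-1 <= L * mj p * mk p) ->
  forall k, (k`!)%:R <= L ^+ k * mj k * mk k.
Proof.
move=> L0 mj0 mk0 hL; elim=> [|k IH]; first by rewrite mj0 mk0 !mulr1.
rewrite factS natrM.
apply: (@le_trans _ _ (k.+1%:R * (L ^+ k * mj k * mk k))).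
  by rewrite ler_pM2l ?ltr0n.
rewrite [leLHS](_ : _ = L ^+ k * (k.+1%:R * mj k * mk k)); last by ring.
apply: (le_trans (ler_wpM2l (exprn_ge0 k L0) (hL k.+1 isT))).
by rewrite exprS le_eqVlt; apply/orP; left; apply/eqP; ring.
Qed.

(** A falling factorial is a binomial coefficient times [k!], and Pascal's rule bounds the former by
    a power of 2. Only the [k!] then needs (A3). *)
Lemma ffact_addn_le (b k : nat) : ((b + k) ^_ k <= 2 ^ (b + k) * k`!)%N.
Proof.
rewrite -bin_ffact leq_mul2r; apply/orP; right.
move: (b + k)%N => n; elim: n k => [|n IH] [|k] //.
  by rewrite bin0 expn_gt0.
by rewrite binS expnS mul2n -addnn leq_add.
Qed.

Lemma ffact_addn_homo (b b' k : nat) :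
  (b <= b')%N -> ((b + k) ^_ k <= (b' + k) ^_ k)%N.
Proof.
by move=> le_bb'; rewrite -!bin_ffact leq_mul2r leq_bin2l ?orbT // leq_add2r.
Qed.

(** * Inner product, norm and Cauchy-Schwarz *)

Section InnerProduct.
Context {R : realType} {H : lmodType R[i]} {ip : H -> H -> R[i]}.
Context (hH : is_hilbert ip).
Implicit Types u v w : H.

Lemma ipDl u v w : ip (u + v) w = ip u w + ip v w.
Proof. by have [+ _ _ _ _] := hH => /(_ 1 u v w); rewrite scale1r mul1r. Qed.

Lemma ip0l w : ip 0 w = 0.
Proof. by apply: (addrI (ip 0 w)); rewrite -ipDl !addr0. Qed.

Lemma ipZl a u w : ip (a *: u) w = a * ip u w.
Proof.
by have [+ _ _ _ _] := hH => /(_ a u 0 w); rewrite addr0 ip0l addr0.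
Qed.

Lemma ipC u v : ip u v = (ip v u)^*%C.
Proof. by have [_ + _ _ _] := hH => /(_ u v). Qed.

Lemma ipBl u v w : ip (u - v) w = ip u w - ip v w.
Proof. by rewrite -scaleN1r ipDl ipZl mulN1r. Qed.

Lemma ipBr u v w : ip w (u - v) = ip w u - ip w v.
Proof. by rewrite ipC ipBl rmorphB /= -!ipC. Qed.

Lemma ipZr a u w : ip w (a *: u) = a^*%C * ip w u.
Proof. by rewrite ipC ipZl rmorphM /= -ipC. Qed.

Lemma ip_ge0 u : 0 <= ip u u.
Proof. by have [_ _ + _ _] := hH; apply. Qed.

Lemma ip_eq0 u : ip u u = 0 -> u = 0.
Proof. by have [_ _ _ + _] := hH; apply. Qed.

Lemma hnorm_ge0 u : 0 <= hnorm ip u. Proof. exact: sqrtr_ge0. Qed.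

Lemma ip_hnorm u : ip u u = (hnorm ip u ^+ 2)%:C%C.
Proof.
have := ip_ge0 u; rewrite lecE /= => /andP[/eqP im0 re0].
by rewrite /hnorm sqr_sqrtr // [LHS]complexE im0 mulr0 addr0.
Qed.

Lemma hnorm_sqr u : hnorm ip u ^+ 2 = cmod (ip u u).
Proof.
rewrite ip_hnorm /Normc.normc /= expr0n addr0 sqrtr_sqr ger0_norm //.
exact: sqr_ge0.
Qed.

Lemma cmodE (z : R[i]) : `|z| = (cmod z)%:C%C. Proof. by []. Qed.

Lemma cmod_ge0 (z : R[i]) : 0 <= cmod z.
Proof. by have := normr_ge0 z; rewrite cmodE lecR. Qed.

Lemma cauchy_schwarz u v : cmod (ip u v) <= hnorm ip u * hnorm ip v.
Proof.
have [v0|vn0] := eqVneq (ip v v) 0.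
  rewrite (ip_eq0 _ v0) ipC ip0l conjc0 Normc.normc0.
  by rewrite mulr_ge0 ?hnorm_ge0.
set a := ip u v / ip v v.
have := ip_ge0 (u - a *: v); rewrite !(ipBl, ipBr, ipZl, ipZr).
rewrite (ipC v u).
have -> : ip u u - a^*%C * ip u v - (a * (ip u v)^*%C - a * (a^*%C * ip v v)) =
          ip u u - ip u v * (ip u v)^*%C / ip v v.
  rewrite /a rmorphM /= fmorphV /= -(ipC v v); field.
  by [].
rewrite -sqr_normc cmodE subr_ge0 ler_pdivrMr; last by rewrite lt_def vn0 ip_ge0.
rewrite !ip_hnorm -rmorphM -rmorphXn lecR -exprMn => h.
by rewrite -ler_sqr ?nnegrE ?mulr_ge0 ?hnorm_ge0 ?cmod_ge0.
Qed.

End InnerProduct.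

(** * Words in the operators on the invariant domain *)

Lemma sum_count_mem (n : nat) (a : seq 'I_n) :
  (\sum_i count_mem i a = size a)%N.
Proof.
elim: a => [|x a IH] /=; first by rewrite big1.
rewrite big_split /= IH (bigD1 x) //= eqxx big1 ?addn0 // => i /negbTE.
by rewrite eq_sym => ->.
Qed.

Section Words.
Context {R : realType} {H : lmodType R[i]} {ip : H -> H -> R[i]}.
Context (hH : is_hilbert ip) {n : nat}.
Context {dom : 'I_n -> H -> Prop} {X : 'I_n -> H -> H} {D : H -> Prop}.
Context (hX : forall j,
  herm_op ip (dom j) (X j) \/ skew_herm_op ip (dom j) (X j)).
Context (hD : forall j u, D u -> dom j u /\ D (X j u)).
Local Notation aw := (apply_word X).

Lemma apply_word_D a v : D v -> D (aw a v).
Proof. by move=> Dv; elim: a => //= i a IH; have [] := hD i _ IH. Qed.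

Lemma in_dom_word_D a v : D v -> in_dom_word dom X a v.
Proof.
move=> Dv; elim: a => //= i a IH; split=> //.
by have [] := hD i _ (apply_word_D a v Dv).
Qed.

Lemma apply_word_cat a b v : aw (a ++ b) v = aw a (aw b v).
Proof. by elim: a => //= i a ->. Qed.

Lemma apply_word_nseq k j v : aw (nseq k j) v = iter k (X j) v.
Proof. by elim: k => //= k ->. Qed.

Lemma in_dom_pow_nseq k j v :
  in_dom_pow (dom j) (X j) k v <-> in_dom_word dom X (nseq k j) v.
Proof. by elim: k => //= k IH; rewrite apply_word_nseq; split=> -[/IH]. Qed.

(** Taking the modulus erases the sign, so Hermitian and skew-Hermitian operators are treated alike
    from here on. *)
Lemma cmod_ip_op j v y : D v -> D y ->
  cmod (ip (X j v) y) = cmod (ip v (X j y)).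
Proof.
move=> Dv Dy; have [dv _] := hD j v Dv; have [dy _] := hD j y Dy.
by case: (hX j) => h; rewrite h // normcN.
Qed.

Lemma cmod_ip_word a v y : D v -> D y ->
  cmod (ip (aw a v) y) = cmod (ip v (aw (rev a) y)).
Proof.
elim: a v y => // i a IH v y Dv Dy /=.
rewrite cmod_ip_op ?IH //; first by rewrite rev_cons -cats1 apply_word_cat.
  by have [] := hD i y Dy.
exact: apply_word_D.
Qed.

(* The operators are not assumed linear: symmetry makes the defect orthogonal to
   [D], and the defect is itself a combination of vectors of [D]. *)
Lemma op_linear j a b v (k : R[i]) : D a -> D b -> D v -> a - b = k *: v ->
  X j a - X j b = k *: X j v.
Proof.
move=> Da Db Dv abv; apply/eqP; rewrite -subr_eq0; apply/eqP.
have orth w : D w -> ip (X j a - X j b - k *: X j v) w = 0.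
  move=> Dw; have [da _] := hD j a Da; have [db _] := hD j b Db.
  have [dv _] := hD j v Dv; have [dw _] := hD j w Dw.
  have lin0 : ip a (X j w) - ip b (X j w) - k * ip v (X j w) = 0.
    by rewrite -(ipBl hH) abv (ipZl hH) subrr.
  rewrite !(ipBl hH) (ipZl hH).
  case: (hX j) => h; rewrite !h //.
  by rewrite -[RHS]oppr0 -lin0; ring.
have [_ DXa] := hD j a Da; have [_ DXb] := hD j b Db.
have [_ DXv] := hD j v Dv.
by apply: (ip_eq0 hH); rewrite !(ipBr hH) (ipZr hH) !orth // mulr0 !subr0.
Qed.

Lemma word_linear w a b v (k : R[i]) : D a -> D b -> D v -> a - b = k *: v ->
  aw w a - aw w b = k *: aw w v.
Proof.
move=> Da Db Dv abv; elim: w => //= i w IH.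
by apply: op_linear => //; apply: apply_word_D.
Qed.

(** * Moving one operator across a word *)

Context {c : 'I_n -> 'I_n -> R[i]}.
Context (hc : forall i j u, D u -> X i (X j u) - X j (X i u) = c i j *: u).

(** [X j] crosses [b2] from right to left; crossing a letter [i] leaves a commutator term in which
    that [i] and the [j] have vanished, with coefficient [c i j]. The bound [f] concerns deletions
    from the whole word [b1 ++ b2], so that it persists when the induction passes a letter from [b2]
    to [b1]. *)
Lemma cmod_ip_move_left j v y (f : 'I_n -> R) b1 b2 : D v -> D y ->
  (forall a1 i a2, b1 ++ b2 = a1 ++ i :: a2 ->
     cmod (c i j) * cmod (ip (aw (a1 ++ a2) v) y) <= f i) ->
  cmod (ip (aw (b1 ++ b2) (X j v)) y) <=
  cmod (ip (aw b1 (X j (aw b2 v))) y) + \sum_i (count_mem i b2)%:R * f i.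
Proof.
move=> Dv Dy; elim: b2 b1 => [|a b2 IH] b1 hf.
  by rewrite cats0 big1 ?addr0 // => i _; rewrite mul0r.
have := IH (rcons b1 a); rewrite cat_rcons => /(_ hf) IH'.
apply: (le_trans IH').
have -> : \sum_i (count_mem i (a :: b2))%:R * f i =
    f a + \sum_i (count_mem i b2)%:R * f i.
  rewrite (bigD1 a) //= [in RHS](bigD1 a) //= eqxx natrD mulrDl mul1r addrA.
  congr (_ + _); apply: eq_bigr => i /negbTE.
  by rewrite eq_sym => ->.
rewrite addrA lerD2r -cats1 apply_word_cat /=.
have Db2 : D (aw b2 v) by apply: apply_word_D.
have [_ DX1] := hD j _ Db2; have [_ DX2] := hD a _ Db2.
have [_ DX3] := hD a _ DX1; have [_ DX4] := hD j _ DX2.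
have /eqP := word_linear b1 _ _ _ _ DX3 DX4 Db2 (hc a j _ Db2).
rewrite subr_eq => /eqP ->.
rewrite (ipDl hH) (ipZl hH).
apply: (le_trans (le_normcD _ _)); rewrite [leLHS]addrC lerD2l Normc.normcM.
by rewrite -apply_word_cat; apply: hf.
Qed.

Lemma cmod_ip_move j v y (f : 'I_n -> R) b : D v -> D y ->
  (forall a1 i a2, b = a1 ++ i :: a2 ->
     cmod (c i j) * cmod (ip (aw (a1 ++ a2) v) y) <= f i) ->
  cmod (ip (aw b (X j v)) y) <=
  cmod (ip (aw b v) (X j y)) + \sum_i (count_mem i b)%:R * f i.
Proof.
move=> Dv Dy hf; rewrite -cmod_ip_op //; last exact: apply_word_D.
exact: (cmod_ip_move_left j v y f [::] b).
Qed.

Context {m : 'I_n -> nat -> R} (mpos : forall j p, 0 < m j p).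
Context (hA0 : condA0 m) (hA1 : condA1 m) (hA2 : condA2 m).

(** * Admitting one new letter [j] to the words over [P] *)

Section AddLetter.
Context {u : H} (Du : D u) {P : pred 'I_n} {j : 'I_n} (Pj : ~~ P j).
Context {B CB A Cj L cc : R}.
Context (B1 : 1 <= B) (CB0 : 0 < CB) (A1 : 1 <= A) (Cj0 : 0 < Cj) (L1 : 1 <= L).
Context (hP : forall a, all P a -> hnorm ip (aw a u) <= CB * B ^+ size a * m_word m a).
Context (hj : forall p, hnorm ip (iter p (X j) u) <= Cj * A ^+ p * m j p).
Context (hL : forall i, c i j != 0 -> forall k, k`!%:R <= L ^+ k * m i k * m j k).
Context (hcc : forall i, cmod (c i j) <= cc).

(* [k i] counts the pairs (letter [i], letter [j]) already cancelled; the falling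
   factorial counts the choices of the cancelled letters [i], in order. *)
Definition contractions (b : seq 'I_n) (k : 'I_n -> nat) : nat :=
  (\prod_i (count_mem i b + k i) ^_ (k i))%N.

(** Here [N i] and [p] stand for the numbers of letters [i] and [j], cancelled ones included, and
    [T] for a bound on the total length. In the base, 2 comes from the binomial coefficients, [B]
    from words over [P], [A] from powers of [X j], and [L] from (A3). *)
Definition ordered_bound (N : 'I_n -> nat) (p T : nat) : R :=
  CB * Cj * (2 * B * A * L) ^+ T * ((\prod_(i | i != j) m i (N i)) * m j p).

Lemma contractions_gt0 b k : (0 < contractions b k)%N.
Proof. by apply: prodn_gt0 => i; rewrite ffact_gt0 leq_addl. Qed.

Lemma contractions_rcons b a k :
  (contractions b k <= contractions (rcons b a) k)%N.
Proof.
apply: leq_prod => i _; apply: ffact_addn_homo.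
by rewrite -cats1 count_cat leq_addr.
Qed.

(** The sum of the count of [i] and [k i] is unchanged, so the falling factorial merely gains one
    factor, the count of [i] before deletion. *)
Lemma contractions_delete a1 i a2 k :
  contractions (a1 ++ a2) (fun l => k l + (l == i))%N =
  (count_mem i (a1 ++ i :: a2) * contractions (a1 ++ i :: a2) k)%N.
Proof.
rewrite /contractions (bigD1 i) //= [in RHS](bigD1 i) //= mulnA.
congr (_ * _)%N.
  rewrite eqxx !count_cat /= eqxx add1n !addnS addn0 !addSn ffactnSr.
  by rewrite mulnC -addSn addnK.
apply: eq_bigr => l /negbTE li.
by rewrite li addn0 !count_cat /= eq_sym li add0n.
Qed.

Lemma ordered_bound_ge0 N p T : 0 <= ordered_bound N p T.
Proof.
rewrite /ordered_bound mulr_ge0 ?mulr_ge0 ?(ltW CB0) ?(ltW Cj0) //.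
  by rewrite exprn_ge0 ?mulr_ge0 ?(le_trans ler01 B1) ?(le_trans ler01 A1) ?(le_trans ler01 L1).
  by apply: prodr_ge0 => i _; apply: ltW.
exact: ltW.
Qed.

(** All letters [j] are now cancelled or in the right factor. The falling factorials become powers
    of 2 times [(k i)!], which (A3) turns into [m i (k i) * m j (k i)]. Log-convexity merges the
    first weights with [m_word m b] into the [m i (N i)], and the second with [m j p] into
    [m j q]. *)
Lemma ordered_bound_base N p q T b k : all P b -> k j = 0%N ->
  (forall i, c i j = 0 -> k i = 0%N) ->
  (forall i, i != j -> count_mem i b + k i = N i)%N ->
  (p + \sum_i k i = q)%N -> (size b + \sum_i k i + p <= T)%N ->
  hnorm ip (aw b u) * hnorm ip (iter p (X j) u) * (contractions b k)%:R
    <= ordered_bound N q T.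
Proof.
move=> Pb kj kc kN <- leT.
have m0 i : m i 0%N = 1 by have [] := hA0 i.
have L0 : 0 <= L by apply: le_trans L1; apply: ler01.
have B0 : 0 <= B by apply: le_trans B1; apply: ler01.
have A0 : 0 <= A by apply: le_trans A1; apply: ler01.
have hQ : (contractions b k)%:R <=
    2 ^+ (size b + \sum_i k i) * L ^+ (\sum_i k i) *
    ((\prod_i m i (k i)) * \prod_i m j (k i)) :> R.
  apply: (@le_trans _ _
      (\prod_i (2 ^+ (count_mem i b + k i) * L ^+ k i * (m i (k i) * m j (k i))))).
    rewrite natr_prod; apply: ler_prod => i _; rewrite ler0n /=.
    apply: (@le_trans _ _ (2 ^+ (count_mem i b + k i) * (k i)`!%:R)).
      by rewrite -natrX -natrM ler_nat ffact_addn_le.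
    rewrite -[leRHS]mulrA ler_wpM2l ?exprn_ge0 //.
    (* (A3) is available only for noncommuting pairs; for the others no cancellation has occurred
       and the factor is 1. *)
    have [c0|cn0] := eqVneq (c i j) 0; last by rewrite mulrA hL.
    by rewrite kc // !m0 !mulr1.
  rewrite !big_split /= !prodrXr !big_split /= sum_count_mem.
  by [].
have hm : m_word m b * (\prod_i m i (k i)) <= \prod_(i | i != j) m i (N i).
  rewrite /m_word -big_split /= (bigD1 j) //= kj (_ : count_mem j b = 0%N).
    rewrite !m0 !mul1r; apply: ler_prod => i ij.
    rewrite mulr_ge0 ?(ltW (mpos _ _)) //= -kN //.
    exact: (log_convex_superM _ _ (mpos i) (m0 i) (hA1 i)).
  by apply/count_memPn; apply: contra Pj => /(allP Pb).
have hmj := log_convex_prod_superM _ _ _ k (mpos j) (m0 j) (hA1 j) p.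
have prod_ge0 (F : 'I_n -> nat) (G : 'I_n -> 'I_n) : 0 <= \prod_i m (G i) (F i).
  by apply: prodr_ge0 => i _; apply: ltW.
have mw0 : 0 <= m_word m b := prod_ge0 (fun i => count_mem i b) id.
have expW (x : R) a b' : 1 <= x -> (a <= b')%N -> x ^+ a <= x ^+ b'.
  by move=> x1 ab; rewrite ler_weXn2l.
apply: (@le_trans _ _ ((CB * B ^+ size b * m_word m b) * (Cj * A ^+ p * m j p) *
   (2 ^+ (size b + \sum_i k i) * L ^+ (\sum_i k i) *
    ((\prod_i m i (k i)) * \prod_i m j (k i))))).
  apply: ler_pM => //; last by apply: ler_pM; rewrite ?hnorm_ge0 ?hP ?hj.
  by rewrite mulr_ge0 ?hnorm_ge0.
rewrite [leLHS](_ : _ = CB * Cj *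
   (2 ^+ (size b + \sum_i k i) * B ^+ size b * A ^+ p * L ^+ (\sum_i k i)) *
   ((m_word m b * \prod_i m i (k i)) * (m j p * \prod_i m j (k i)))); last by ring.
rewrite /ordered_bound !exprMn.
have ge0 := exprn_ge0.
apply: ler_pM; last 1 first.
- apply: ler_pM => //; first by rewrite mulr_ge0 ?mw0 ?(prod_ge0 k id).
  by rewrite mulr_ge0 ?(prod_ge0 k (fun=> j)) ?ltW.
- by rewrite !mulr_ge0 ?ge0 ?(ltW CB0) ?(ltW Cj0).
- by rewrite !mulr_ge0 ?mw0 ?(prod_ge0 k id) ?(prod_ge0 k (fun=> j)) ?ltW.
rewrite ler_wpM2l ?mulr_ge0 ?(ltW CB0) ?(ltW Cj0) //.
have hT1 : (size b + \sum_i k i <= T)%N by apply: leq_trans leT; rewrite leq_addr.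
have hT2 : (size b <= T)%N by apply: leq_trans hT1; rewrite leq_addr.
have hT3 : (\sum_i k i <= T)%N by apply: leq_trans hT1; rewrite leq_addl.
have hT4 : (p <= T)%N by apply: leq_trans leT; rewrite leq_addl.
do 3!(apply: ler_pM; [by rewrite ?mulr_ge0 ?ge0|by rewrite ?ge0| |by apply: expW]).
by apply: expW => //; rewrite ler1n.
Qed.

(* The cancellations already made are a parameter of the induction: in the
   weighted inequality one more of them multiplies [contractions] by exactly the
   number of letters [i] left to choose from, and the right-hand side depends
   only on the totals [N], [q], [T], which a cancellation does not change. *)
Lemma cmod_ip_ordered_le N q T w p b k : all P b ->
  all (fun i => P i || (i == j)) w -> k j = 0%N ->
  (forall i, c i j = 0 -> k i = 0%N) ->
  (forall i, i != j -> count_mem i b + k i + count_mem i w = N i)%N ->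
  (p + count_mem j w + \sum_i k i = q)%N ->
  (size b + \sum_i k i + size w + p <= T)%N ->
  cmod (ip (aw b (aw w u)) (iter p (X j) u)) * (contractions b k)%:R
    <= (1 + n%:R * cc) ^+ count_mem j w * ordered_bound N q T.
Proof.
have cc0 : 0 <= cc := le_trans (cmod_ge0 _) (hcc j).
have K0 : 0 <= 1 + n%:R * cc by rewrite addr_ge0 ?mulr_ge0.
have Dp r : D (iter r (X j) u) by rewrite -apply_word_nseq; apply: apply_word_D.
elim: w p b k => [|a w IH] p b k Pb Pw kj kc kN hq hT.
  rewrite mul1r.
  have hb : hnorm ip (aw b u) * hnorm ip (iter p (X j) u) * (contractions b k)%:R
      <= ordered_bound N q T.
    apply: ordered_bound_base => //.
  - by move=> i ij; rewrite -kN //= addn0.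
  - by rewrite -hq /= addn0.
  - by rewrite /= addn0 in hT.
  apply: le_trans hb.
  by rewrite ler_wpM2r // cauchy_schwarz.
move: Pw => /= /andP[Paj Pw].
(* A letter of [P] simply joins the sorted word [b], which can only increase [contractions]. *)
have [aj|anj] := eqVneq a j; last first.
  have Pa : P a by move: Paj; rewrite (negbTE anj) orbF.
  have -> : aw b (X a (aw w u)) = aw (rcons b a) (aw w u).
    by rewrite -cats1 apply_word_cat.
  rewrite add0n.
  apply: (@le_trans _ _ (cmod (ip (aw (rcons b a) (aw w u)) (iter p (X j) u)) *
      (contractions (rcons b a) k)%:R)).
    by rewrite ler_wpM2l ?cmod_ge0 // ler_nat contractions_rcons.
  apply: IH => //.
  - by rewrite all_rcons Pa.
  - by move=> i ij; rewrite -kN //= -cats1 count_cat /=; clear; lia.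
  - by move: hq => /=; rewrite (negbTE anj) add0n.
  - by move: hT; rewrite /= size_rcons; clear; lia.
subst a; rewrite /= add1n exprS -mulrA.
have Dw : D (aw w u) by apply: apply_word_D.
set E := _ ^+ _ * ordered_bound _ _ _.
have E0 : 0 <= E by rewrite mulr_ge0 ?exprn_ge0 ?ordered_bound_ge0.
set Q := (contractions b k)%:R.
have Q0 : 0 < Q by rewrite ltr0n contractions_gt0.
(* The induction hypothesis after deleting one [i], divided by its weight, which is the count of [i]
   times [Q]; [cc] bounds the commutator constant. For a zero count the division gives 0, harmless
   because [f i] is later multiplied by that count. *)
pose f i := cc * (E / (count_mem i b)%:R / Q).
have hf a1 i a2 : b = a1 ++ i :: a2 ->
    cmod (c i j) * cmod (ip (aw (a1 ++ a2) (aw w u)) (iter p (X j) u)) <= f i.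
  move=> eb; have [c0|cn0] := eqVneq (c i j) 0.
    by rewrite c0 Normc.normc0 mul0r /f mulr_ge0 ?divr_ge0 ?ler0n // ltW.
  have Pi : P i by move/allP: Pb; apply; rewrite eb mem_cat mem_head orbT.
  have ij : i != j by apply: contraNneq Pj => <-.
  have cnt0 : 0 < (count_mem i b)%:R :> R.
    by rewrite ltr0n -has_count has_pred1 eb mem_cat mem_head orbT.
  have sumk : (\sum_l (k l + (l == i)) = \sum_l k l + 1)%N.
    rewrite big_split /= -[1%N]/(size [:: i]) -sum_count_mem; congr (_ + _)%N.
    by apply: eq_bigr => l _; rewrite /= addn0 eq_sym.
  apply: ler_pM; rewrite ?cmod_ge0 //.
  rewrite ler_pdivlMr // ler_pdivlMr // -mulrA -natrM mulnC.
  rewrite eb -contractions_delete; apply: IH => //.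
  - by move: Pb; rewrite eb !all_cat /= => /and3P[-> _ ->].
  - by rewrite kj eq_sym (negbTE ij).
  - move=> l cl; rewrite kc //; case: eqP => // li; move: cn0.
    by rewrite -li cl eqxx.
  - move=> l lj; rewrite -kN // eb !count_cat /= (eq_sym i l) (eq_sym j l) (negbTE lj).
    by clear; lia.
  - by rewrite sumk -hq /= eqxx; clear; lia.
  - by move: hT; rewrite sumk eb !size_cat /=; clear; lia.
have hmove := cmod_ip_move j _ _ f b Dw (Dp p) hf.
apply: (le_trans (ler_wpM2r (ltW Q0) hmove)).
(* In the factor [1 + n * cc], the 1 pays for the term where [X j] reaches the right factor, and
   [n * cc] for the commutator terms, at most [cc * E] for each letter after weighting. *)
rewrite mulrDl [leRHS]mulrDl mul1r lerD //.
  apply: (IH p.+1) => //.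
  - by move=> i ij; rewrite -kN //= eq_sym (negbTE ij).
  - by rewrite -hq /= eqxx; clear; lia.
  - by move: hT => /=; clear; lia.
rewrite -ler_pdivlMr //.
apply: (@le_trans _ _ (\sum_(i < n) cc * (E / Q))).
  apply: ler_sum => i _; rewrite /f mulrCA ler_wpM2l //.
  have [->|cn0] := eqVneq (count_mem i b) 0%N.
    by rewrite mul0r divr_ge0 // ltW.
  rewrite mulrA mulrCA divff ?mulr1 //.
  by rewrite pnatr_eq0.
by rewrite sumr_const card_ord -[X in X <= _]mulr_natl !mulrA.
Qed.

(** The ordering inequality is applied to [rev a ++ a] with an empty sorted part and no
    cancellations; (A2) with equal indices then splits each doubled weight into a square. *)
Lemma hnorm_word_add_letter_le (h : R) : 1 <= h ->
  (forall i p q, m i (p + q)%N <= h ^+ (p + q) * m i p * m i q) ->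
  forall a, all (fun i => P i || (i == j)) a ->
  hnorm ip (aw a u) <=
  (1 + CB * Cj) * ((1 + n%:R * cc) * (2 * B * A * L) * h) ^+ size a * m_word m a.
Proof.
move=> h1 hm a Pa.
have cc0 : 0 <= cc := le_trans (cmod_ge0 _) (hcc j).
have K1 : 1 <= 1 + n%:R * cc by rewrite lerDl mulr_ge0.
set K := 1 + _ in K1 *; set V := 2 * B * A * L.
have K0 : 0 <= K by apply: le_trans K1; apply: ler01.
have h0 : 0 <= h by apply: le_trans h1; apply: ler01.
have V0 : 0 <= V.
  by rewrite /V !mulr_ge0 ?(le_trans ler01 B1) ?(le_trans ler01 A1) ?(le_trans ler01 L1).
have W0 : 0 <= K * V * h := mulr_ge0 (mulr_ge0 K0 V0) h0.
have mw0 : 0 <= m_word m a by apply: prodr_ge0 => i _; apply: ltW.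
have CC0 : 0 <= CB * Cj by rewrite mulr_ge0 ?ltW.
have cnt_rev i : count_mem i (rev a ++ a) = (count_mem i a + count_mem i a)%N.
  by rewrite count_cat count_rev.
have := cmod_ip_ordered_le (fun i => count_mem i a + count_mem i a)%N
  (count_mem j a + count_mem j a) (size a + size a) (rev a ++ a) 0 [::] (fun=> 0%N).
rewrite all_cat all_rev Pa cnt_rev big1 // addn0 size_cat size_rev addn0 leqnn.
move=> /(_ isT isT erefl (fun _ _ => erefl)).
have -> : contractions [::] (fun=> 0%N) = 1%N by apply: big1.
move=> /(_ (fun i _ => cnt_rev i) erefl isT).
rewrite mulr1 /= apply_word_cat cmod_ip_word ?revK //; last exact: apply_word_D.
rewrite -(hnorm_sqr hH) => hsq.
rewrite -ler_sqr ?nnegrE ?hnorm_ge0 //; last first.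
  by rewrite (mulr_ge0 (mulr_ge0 _ (exprn_ge0 _ W0))) ?addr_ge0.
apply: (le_trans hsq); rewrite /ordered_bound -/V.
have -> : (\prod_(i | i != j) m i (count_mem i a + count_mem i a)%N) *
    m j (count_mem j a + count_mem j a)%N =
    \prod_i m i (count_mem i a + count_mem i a)%N.
  by rewrite [RHS](bigD1 j) //= mulrC.
have hprod : \prod_i m i (count_mem i a + count_mem i a)%N <=
    h ^+ (size a + size a) * m_word m a ^+ 2.
  apply: (@le_trans _ _ (\prod_i (h ^+ (count_mem i a + count_mem i a) *
      (m i (count_mem i a) * m i (count_mem i a))))).
    by apply: ler_prod => i _; rewrite ltW //= mulrA.
  by rewrite !big_split /= prodrXr big_split /= sum_count_mem expr2.
have hK : K ^+ (count_mem j a + count_mem j a) <= K ^+ (size a + size a).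
  by rewrite ler_weXn2l // leq_add ?count_size.
apply: (@le_trans _ _ (K ^+ (size a + size a) *
   (CB * Cj * V ^+ (size a + size a) *
     (h ^+ (size a + size a) * m_word m a ^+ 2)))).
  apply: ler_pM => //; rewrite ?exprn_ge0 //.
    by rewrite mulr_ge0 ?(mulr_ge0 CC0) ?exprn_ge0 ?prodr_ge0 // => i _; apply: ltW.
  by rewrite ler_wpM2l // (mulr_ge0 CC0 (exprn_ge0 _ V0)).
rewrite [leLHS](_ : _ = CB * Cj * ((K * V * h) ^+ size a * m_word m a) ^+ 2); last first.
  by rewrite !exprD !exprMn; ring.
rewrite -[(1 + _) * _ * _]mulrA [leRHS]exprMn ler_wpM2r ?sqr_ge0 //.
(* The constant [1 + CB * Cj] avoids a square root: its square dominates [CB * Cj]. *)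
by move: (CB * Cj) CC0 => x x0; rewrite sqrrD; have := sqr_ge0 x; lra.
Qed.
End AddLetter.

Context (hA3 : forall i j, c i j != 0 -> condA3 (m i) (m j)).

(** Normalizes the constants: [1 + A] is at least 1, and adding the norm of [u] to [C] covers the
    exponent 0. *)
Lemma GSR1_bound j u : GSR1 ip (dom j) (X j) (m j) u ->
  exists A C : R, [/\ 1 <= A, 0 < C &
    forall p, hnorm ip (iter p (X j) u) <= C * A ^+ p * m j p].
Proof.
case=> _ [A [C [A0 [C0 hAC]]]]; exists (1 + A), (C + hnorm ip u).
have u0 : 0 <= hnorm ip u by apply: hnorm_ge0.
have A1 : 1 <= 1 + A by rewrite lerDl ltW.
split=> // [|[|p]]; first by rewrite ltr_pwDl.
  by have [-> _] := hA0 j; rewrite expr0 !mulr1 /= lerDr ltW.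
apply: (le_trans (hAC p.+1 isT)); rewrite ler_pM2r //.
apply: ler_pM; rewrite ?exprn_ge0 ?(ltW A0) ?(ltW C0) //.
  by rewrite lerDl.
by rewrite lerXn2r ?nnegrE ?addr_ge0 ?ltW // ltr_pwDl // ltW.
Qed.

(** The constant of (A3) depends on [i]; one plus the sum over the finitely many [i] serves all of
    them. *)
Lemma condA3_fact j : exists2 L : R, 1 <= L &
  forall i, c i j != 0 -> forall k, k`!%:R <= L ^+ k * m i k * m j k.
Proof.
have /fin_all_exists[L hL] i : exists L : R, 0 <= L /\
    (c i j != 0 -> forall k, k`!%:R <= L ^+ k * m i k * m j k).
  have [c0|cn0] := eqVneq (c i j) 0; first by exists 0.
  have [L [L1 hL]] := hA3 i j cn0.
  have L0 : 0 <= L by apply: le_trans L1; apply: ler01.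
  exists L; split=> // _ k.
  by have [mi0 _] := hA0 i; have [mj0 _] := hA0 j; apply: fact_le_weights.
have L0 i : 0 <= L i by have [] := hL i.
exists (1 + \sum_i L i); first by rewrite lerDl sumr_ge0.
move=> i cn0 k; have [_ /(_ cn0 k) hk] := hL i.
apply: (le_trans hk); rewrite -!mulrA ler_wpM2r ?mulr_ge0 ?(ltW (mpos _ _)) //.
have Li : L i <= 1 + \sum_l L l.
  by rewrite (bigD1 i) //= addrCA lerDl addr_ge0 ?sumr_ge0.
by rewrite lerXn2r ?nnegrE // (le_trans (L0 i)).
Qed.

Lemma hnorm_words_bound u (s : seq 'I_n) : D u ->
  (forall j, GSR1 ip (dom j) (X j) (m j) u) ->
  exists B C : R, [/\ 1 <= B, 0 < C &
    forall a, all (fun i => i \in s) a ->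
      hnorm ip (aw a u) <= C * B ^+ size a * m_word m a].
Proof.
move=> Du hu; elim: s => [|j s [B [CB [B1 CB0 hs]]]].
  have u0 : 0 <= hnorm ip u by apply: hnorm_ge0.
  exists 1, (1 + hnorm ip u); split=> // [|[|i a] //= _].
    by rewrite ltr_pwDl.
  by rewrite /m_word big1 ?mulr1 ?lerDr // => i _; have [] := hA0 i.
(* A repeated letter admits no new words; a new one satisfies the requirement that [j] lie outside
   [P]. *)
have [js|js] := boolP (j \in s).
  exists B, CB; split=> // a ha; apply: hs.
  apply: sub_all ha => i; rewrite /= in_cons => /predU1P[->|//].
  exact: js.
have [A [Cj [A1 Cj0 hj]]] := GSR1_bound j u (hu j).
have [L L1 hL] := condA3_fact j.
have [h0 [h0_gt0 hm]] := hA2.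
have hm1 i p q : m i (p + q)%N <= (1 + h0) ^+ (p + q) * m i p * m i q.
  apply: (le_trans (hm i p q)).
  rewrite -!mulrA ler_wpM2r ?mulr_ge0 ?(ltW (mpos _ _)) //.
  by rewrite lerXn2r ?nnegrE ?addr_ge0 ?(ltW h0_gt0) // lerDr.
have hcc i : cmod (c i j) <= \sum_l cmod (c l j).
  by rewrite (bigD1 i) //= lerDl sumr_ge0 // => l _; apply: cmod_ge0.
have h1 : 1 <= 1 + h0 by rewrite lerDl ltW.
have := hnorm_word_add_letter_le Du js B1 CB0 A1 Cj0 L1 hs hj hL hcc _ h1 hm1.
set W := _ * _ * (1 + h0) => hW.
have cc0 : 0 <= \sum_l cmod (c l j) by rewrite sumr_ge0 // => l _; apply: cmod_ge0.
exists W, (1 + CB * Cj); split.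
- rewrite /W !mulr_ege1 //; last by rewrite ler1n.
  by rewrite lerDl mulr_ge0.
- by rewrite ltr_pwDl // mulr_ge0 ?ltW.
- move=> a ha; apply: hW; apply: sub_all ha => i.
  by rewrite /= in_cons orbC.
Qed.
End Words.

Theorem theorem2p6 (R : realType) (H : lmodType R[i]) (ip : H -> H -> R[i])
  (hH : is_hilbert ip) (n : nat) (hn : (1 <= n)%N)
  (dom : 'I_n -> H -> Prop) (X : 'I_n -> H -> H)
  (hX : forall j, herm_op ip (dom j) (X j) \/ skew_herm_op ip (dom j) (X j))
  (D : H -> Prop)
  (hD : forall j u, D u -> dom j u /\ D (X j u))
  (c : 'I_n -> 'I_n -> R[i])
  (hc : forall i j u, D u -> X i (X j u) - X j (X i u) = c i j *: u)
  (m : 'I_n -> nat -> R) (mpos : forall j p, 0 < m j p)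
  (hA0 : condA0 m) (hA1 : condA1 m) (hA2 : condA2 m)
  (hA3 : forall i j, c i j != 0 -> condA3 (m i) (m j))
  (u : H) (hu : D u) :
  GSR ip dom X m u <-> (forall j, GSR1 ip (dom j) (X j) (m j) u).
Proof.
(* Invariance of [D] settles all domain conditions, leaving only the norm estimates. *)
have cinf : Cinf dom X u by move=> a _; apply: (in_dom_word_D hD).
split=> [[_ [A [C [A0 [C0 hAC]]]]] j | h].
  split=> [k|]; first by apply/in_dom_pow_nseq; apply: (in_dom_word_D hD).
  exists A, C; split=> //; split=> // k k1.
  (* On a word with the single letter [j], the other weights are [m i 0 = 1]. *)
  have := hAC (nseq k j); rewrite size_nseq apply_word_nseq => /(_ k1).
  rewrite /m_word (bigD1 j) //= big1 ?mulr1 => [|i /negbTE ij].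
    by rewrite count_nseq /= eqxx mul1n.
  by rewrite count_nseq /= eq_sym ij mul0n; have [] := hA0 i.
split=> //.
have [B [C [B1 C0 hB]]] :=
  hnorm_words_bound hH hX hD hc mpos hA0 hA1 hA2 hA3 u (enum 'I_n) hu h.
exists B, C; split; first exact: lt_le_trans ltr01 B1.
split=> // a _; apply: hB; apply/allP => i _.
by rewrite /= mem_enum.
Qed.
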